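(* Fix $k\ge3$. Say a permutation $\pi=\pi_1\cdots\pi_m$ contains $\Lambda_k$ if there are indices $i_1<i_2<\cdots<i_k$ with $\pi_{i_k}>\pi_{i_j}$ for all $j<k$ (no condition on the relative order of $\pi_{i_1},\dots,\pi_{i_{k-1}}$), and avoids $\Lambda_k$ otherwise. Let $a(m)$ (resp. $b(m)$) be the number of $\Lambda_k$-avoiding up-down (resp. down-up) permutations of $\{1,\dots,m\}$. Then $a(m)=b(m)=E_m$ for $0\le m<k$, where $\sum_{m\ge0}E_m\frac{t^m}{m!}=\sec t+\tan t$, and whenever the index on the left-hand side is at least $k$, $$a(2n)=\sum_{i=1}^{\lfloor (k-1)/2\rfloor}(-1)^{i+1}\binom{k-1}{2i}a(2n-2i),\qquad a(2n+1)=\sum_{i=0}^{\lfloor (k-2)/2\rfloor}(-1)^{i}\binom{k-1}{2i+1}a(2n-2i),$$ $$b(2n)=\sum_{i=0}^{\lfloor (k-2)/2\rfloor}(-1)^{i}\binom{k-1}{2i+1}b(2n-2i-1),\qquad b(2n+1)=\sum_{i=1}^{\lfloor (k-1)/2\rfloor}(-1)^{i+1}\binom{k-1}{2i}b(2n-2i+1).$$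
   Context: Up-down: $\pi_1<\pi_2>\pi_3<\cdots$; down-up: $\pi_1>\pi_2<\pi_3>\cdots$. $\Lambda_k$ is the partially ordered pattern given by the flat poset on $\{1,\dots,k\}$ in which $k$ is greater than each of $1,\dots,k-1$ and $1,\dots,k-1$ are pairwise incomparable. By reverse/complement symmetry the same numbers count alternating permutations avoiding the other flat patterns (maximum or minimum element labeled $1$ or $k$). *)

(* Defs.v *)
(* MathComp / MathComp-Analysis.
   A permutation pi_1 ... pi_m of {1,...,m} is s : 'S_m, with indices and values
   shifted by one: pi_(i+1) = s i + 1 for i : 'I_m. *)
From mathcomp Require Import all_boot all_order all_algebra all_fingroup.
From mathcomp Require Import all_classical all_reals all_analysis.

Set Implicit Arguments.
Unset Strict Implicit.
Unset Printing Implicit Defensive.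

Import Order.TTheory GRing.Theory Num.Theory.
Import numFieldNormedType.Exports.

(* Because of the shift, 1-based odd positions are the even i : 'I_m. *)
Definition up_down m (s : 'S_m) : bool :=
  [forall i : 'I_m, forall j : 'I_m, (j == i.+1 :> nat) ==>
     (if odd i then s j < s i else s i < s j)].

Definition down_up m (s : 'S_m) : bool :=
  [forall i : 'I_m, forall j : 'I_m, (j == i.+1 :> nat) ==>
     (if odd i then s i < s j else s j < s i)].

(* f lists the indices i_1 < ... < i_k; [l.+1 == k] says that l is the last
   element of 'I_k, so [f l] is i_k. *)
Definition contains_Lambda k m (s : 'S_m) : bool :=
  [exists f : {ffun 'I_k -> 'I_m},
     [forall j : 'I_k, forall l : 'I_k, (j < l) ==> (f j < f l)] &&
     [forall j : 'I_k, forall l : 'I_k,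
        (j < l) && (l.+1 == k) ==> (s (f j) < s (f l))]].

Definition avoids_Lambda k m (s : 'S_m) : bool := ~~ contains_Lambda k s.

Definition num_up_down k m : nat :=
  #|[set s : 'S_m | up_down s && avoids_Lambda k s]|.

Definition num_down_up k m : nat :=
  #|[set s : 'S_m | down_up s && avoids_Lambda k s]|.

(* The power series identity sum_m E_m t^m / m! = sec t + tan t, read as an
   expansion about 0; it determines E uniquely. *)
Definition sec_tan_egf (R : realType) (E : nat -> nat) : Prop :=
  (\forall t \near (0 : R),
     pseries (fun m => (E m)%:R / (m`!)%:R) t @ \oo --> (cos t)^-1 + tan t)%R%classic.

(* Main.v *)
(* Let the left rank of the entry pi_i be the number of j < i with pi_j <
   pi_i. A permutation avoids Lambda_k iff all its left ranks are smaller
   than N = k - 1, and pi_i < pi_(i+1) iff the left rank increases strictly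
   from i to i+1. So one counts words of left ranks c_0 ... c_(m-1) with c_i
   <= min(i, N - 1) that alternate between strict ascents and weak descents.
   Let r have the parity for which a weak descent is due after the letter
   number m - r. Follow an alternating word of length m - r by an arbitrary
   strictly increasing word of length r over {0, ..., N - 1}; for N <= m the
   bound c_i <= i holds automatically on the second word, so there are C(N,
   r) a(m - r) such pairs. If there is a weak descent at the junction, the
   alternating part extends by two letters; otherwise the increasing part
   extends by two letters to the left. Hence the alternating sum over r
   telescopes. For N = m the bound N is void, and the same sum is the
   coefficient identity of (sec t + tan t) cos t = 1 + sin t. *)
Require Import Defs.
From mathcomp Require Import all_boot all_order all_algebra all_fingroup.
From mathcomp Require Import all_classical all_reals all_analysis.
From mathcomp Require Import zify ring.

Import Order.TTheory GRing.Theory Num.Theory.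
Import numFieldNormedType.Exports.

Set Implicit Arguments.
Unset Strict Implicit.
Unset Printing Implicit Defensive.

(** * Alternating permutations of both kinds *)

(** The bit [p] is [false] for up-down and [true] for down-up, so that one argument serves both; a
    descent is due after index [i] when [odd i (+) p]. *)
Definition alt_perm (p : bool) m (s : 'S_m) : bool :=
  [forall i : 'I_m, forall j : 'I_m, (j == i.+1 :> nat) ==>
     (if odd i (+) p then s j < s i else s i < s j)].

Lemma alt_permP p m (s : 'S_m) :
  reflect (forall i j : 'I_m, j = i.+1 :> nat ->
             if odd i (+) p then s j < s i else s i < s j)
          (alt_perm p s).
Proof.
apply: (iffP forallP) => [H i j /eqP ij | H i].
  by move/forallP/(_ j)/implyP: (H i); apply.
by apply/forallP => j; apply/implyP => /eqP; apply: H.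
Qed.

Lemma up_down_alt_perm m (s : 'S_m) : up_down s = alt_perm false s.
Proof. by do 2! [apply: eq_forallb => ?]; rewrite addbF. Qed.

Lemma down_up_alt_perm m (s : 'S_m) : down_up s = alt_perm true s.
Proof. by do 2! [apply: eq_forallb => ?]; rewrite addbT if_neg. Qed.

(** * Left ranks and avoidance of Lambda_k *)

Lemma card_ord_lt m n : n <= m -> #|[set j : 'I_m | j < n]| = n.
Proof.
move=> le_nm; rewrite -sum1dep_card (big_ord_narrow le_nm).
by rewrite sum1_card card_ord.
Qed.

Definition left_rank m (s : 'S_m) (i : 'I_m) : nat :=
  #|[set j : 'I_m | (j < i) && (s j < s i)]|.

Lemma left_rank_le m (s : 'S_m) i : left_rank s i <= i.
Proof.
rewrite -[X in _ <= X](card_ord_lt (ltnW (ltn_ord i))).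
by apply/subset_leq_card/fintype.subsetP => j; rewrite !inE => /andP[].
Qed.

(** The pattern does not constrain its first [N] entries among themselves, so any [N] earlier
    smaller entries, taken in order of position, complete an occurrence ending at [i]. *)
Lemma contains_LambdaE N m (s : 'S_m) :
  contains_Lambda N.+1 s = [exists i, N <= left_rank s i].
Proof.
apply/existsP/existsP => [[f /andP[/forallP f_incr /forallP f_max]] | [i]].
  exists (f ord_max).
  have f_inj : injective (fun j : 'I_N => f (widen_ord (leqnSn N) j)).
    have lt_f (j l : 'I_N) : j < l ->
        f (widen_ord (leqnSn N) j) < f (widen_ord (leqnSn N) l).
      by move=> lt_jl; move/forallP/(_ (widen_ord (leqnSn N) l))/implyP:
        (f_incr (widen_ord (leqnSn N) j)); apply.
    move=> j l fjl; apply: val_inj; case: (ltngtP j l) => // /lt_f.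
      by rewrite fjl ltnn.
    by rewrite fjl ltnn.
  rewrite -[X in X <= _]card_ord -(card_imset _ f_inj).
  apply/subset_leq_card/fintype.subsetP => _ /imsetP[j _ ->]; rewrite inE.
  apply/andP; split.
    by move/forallP/(_ ord_max)/implyP: (f_incr (widen_ord (leqnSn N) j));
      apply; apply: (ltn_ord j).
  move/forallP/(_ ord_max)/implyP: (f_max (widen_ord (leqnSn N) j)); apply.
  by rewrite eqxx andbT; apply: (ltn_ord j).
rewrite /left_rank cardE; set A := [set _ | _] => leN.
(* The first [N] such positions, then [i]; the list increases because [enum] lists ordinals in
   increasing order. *)
pose e := rcons (take N (enum A)) i.
have size_e : size e = N.+1 by rewrite size_rcons size_takel.
have e_in (j : nat) : j < N -> nth i e j \in A.
  move=> ltj; rewrite nth_rcons size_takel // ltj nth_take //.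
  by rewrite -mem_enum mem_nth // (leq_trans ltj).
have e_last : nth i e N = i by rewrite nth_rcons size_takel // ltnn eqxx.
have lt_enum : sorted (fun x y : 'I_m => x < y) (enum A).
  have -> : enum A = [seq x <- enum 'I_m | x \in A] by rewrite enumT.
  apply: sorted_filter; first by move=> ? ? ?; apply: ltn_trans.
  have := iota_ltn_sorted 0 m; rewrite -val_enum_ord sorted_map.
  exact.
have e_incr (j l : nat) : j < l <= N -> nth i e j < nth i e l.
  case/andP => lt_jl; rewrite leq_eqVlt => /predU1P[lN | lt_lN].
    by rewrite lN e_last; have := e_in j; rewrite -lN inE => /(_ lt_jl)/andP[].
  have lt_jN := ltn_trans lt_jl lt_lN.
  rewrite !nth_rcons size_takel // lt_lN lt_jN !nth_take //.
  apply: (sorted_ltn_nth _ i lt_enum) => //; rewrite ?inE.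
  - by move=> ? ? ?; apply: ltn_trans.
  - exact: leq_trans leN.
  - exact: leq_trans leN.
exists [ffun j : 'I_N.+1 => nth i e j]; apply/andP; split.
  apply/forallP => j; apply/forallP => l; apply/implyP => lt_jl; rewrite !ffunE.
  by apply: e_incr; rewrite lt_jl -ltnS ltn_ord.
apply/forallP => j; apply/forallP => l; apply/implyP => /andP[lt_jl /eqP[lN]].
rewrite !ffunE lN e_last; rewrite lN in lt_jl.
by have:= e_in _ lt_jl; rewrite inE => /andP[].
Qed.

Lemma avoids_LambdaP N m (s : 'S_m) :
  reflect (forall i, left_rank s i < N) (avoids_Lambda N.+1 s).
Proof.
rewrite /avoids_Lambda contains_LambdaE negb_exists.
by apply: (iffP forallP) => H i; move: (H i); rewrite -ltnNge.
Qed.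

Lemma avoids_Lambda_small N m (s : 'S_m) : m <= N -> avoids_Lambda N.+1 s.
Proof.
move=> le_mN; apply/avoids_LambdaP => i; apply: leq_trans le_mN.
exact: leq_ltn_trans (left_rank_le s i) (ltn_ord i).
Qed.

(** * Appending a last entry *)

Lemma ltn_lift n (h : 'I_n.+1) (i j : 'I_n) : (lift h i < lift h j) = (i < j).
Proof. by rewrite /= ltnNge leq_bump2 -ltnNge. Qed.

Lemma ltn_lift_self n (h : 'I_n.+1) (i : 'I_n) : (lift h i < h) = (i < h).
Proof. by rewrite /= /bump; lia. Qed.

Lemma gtn_lift_self n (h : 'I_n.+1) (i : 'I_n) : (h < lift h i) = (h <= i).
Proof. by rewrite /= /bump; lia. Qed.

(** Appending [x] raises the old values that are at least [x] by one. An old last value [y] thus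
    ends above [x] exactly when [x <= y], which is why descents become weak. *)
Lemma alt_perm_lift p m (s : 'S_m.+1) (x : 'I_m.+2) :
  alt_perm p (lift_perm ord_max x s) =
  alt_perm p s &&
    (if odd m (+) p then x <= s ord_max else s ord_max < x).
Proof.
apply/alt_permP/andP => [H | [/alt_permP H Hx] i j].
  split.
    apply/alt_permP => i j ij.
    have:= H (lift ord_max i) (lift ord_max j).
    by rewrite !lift_perm_lift !ltn_lift !lift_max; apply.
  have:= H (lift ord_max ord_max) ord_max.
  rewrite lift_perm_lift lift_perm_id ltn_lift_self gtn_lift_self lift_max.
  by apply.
case: (unliftP ord_max j) => [j' -> | ->].
  case: (unliftP ord_max i) => [i' -> | ->]; rewrite ?lift_max.
    by rewrite !lift_perm_lift !ltn_lift; apply: H.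
  by have:= ltn_ord j' => /=; lia.
case: (unliftP ord_max i) => [i' -> | ->]; last by move=> /=; lia.
rewrite lift_max => -[mi]; have -> : i' = ord_max by apply: val_inj.
by rewrite lift_perm_lift lift_perm_id ltn_lift_self gtn_lift_self.
Qed.

Lemma left_rank_lift m (s : 'S_m) (x : 'I_m.+1) (i : 'I_m) :
  left_rank (lift_perm ord_max x s) (lift ord_max i) = left_rank s i.
Proof.
rewrite /left_rank -[RHS](card_imset _ (@lift_inj _ ord_max)).
congr #|pred_of_set _|; apply/setP => j; rewrite inE; apply/idP/imsetP => [|[j']].
  case: (unliftP ord_max j) => [j' -> | ->].
    rewrite !lift_perm_lift !ltn_lift => ltj.
    by exists j'; rewrite ?inE.
  by rewrite lift_max /= ltnNge ltnW ?ltn_ord.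
by rewrite inE => ltj ->; rewrite !lift_perm_lift !ltn_lift.
Qed.

(** All other positions precede the last one, so its left rank counts all smaller values. *)
Lemma left_rank_max m (s : 'S_m.+1) : left_rank s ord_max = s ord_max.
Proof.
have -> : left_rank s ord_max = #|s @^-1: [set x : 'I_m.+1 | x < s ord_max]|.
  congr #|pred_of_set _|; apply/setP => j; rewrite !inE.
  case: (unliftP ord_max j) => [j' -> | ->]; last by rewrite !ltnn.
  by rewrite lift_max /= ltn_ord.
by rewrite card_preimset ?card_ord_lt //; [apply: ltnW | apply: perm_inj].
Qed.

Lemma avoids_Lambda_lift N m (s : 'S_m) (x : 'I_m.+1) :
  avoids_Lambda N.+1 (lift_perm ord_max x s) = avoids_Lambda N.+1 s && (x < N).
Proof.
apply/avoids_LambdaP/andP => [H | [/avoids_LambdaP H ltx] i].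
  split; last by have:= H ord_max; rewrite left_rank_max lift_perm_id.
  by apply/avoids_LambdaP => i; have:= H (lift ord_max i); rewrite left_rank_lift.
case: (unliftP ord_max i) => [i' -> | ->]; first by rewrite left_rank_lift.
by rewrite left_rank_max lift_perm_id.
Qed.

(** The map from pairs [(x, t)] to [lift_perm i x t] is injective between sets of equal size, hence
    bijective. *)
Lemma lift_perm_surj m (i : 'I_m.+1) (s : 'S_m.+1) :
  exists t : 'S_m, s = lift_perm i (s i) t.
Proof.
pose h (u : 'I_m.+1 * 'S_m) : 'S_m.+1 := lift_perm i u.1 u.2.
have h_inj : injective h.
  move=> [x t] [y u]; rewrite /h /= => /permP eq_lift.
  have xy : x = y by have := eq_lift i; rewrite !lift_perm_id.
  congr (_, _) => //; apply/permP => j.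
  by have := eq_lift (lift i j); rewrite !lift_perm_lift xy => /lift_inj.
have [|g _ gK] := inj_card_bij h_inj.
  by rewrite card_prod card_ord !card_Sn factS.
have := gK s; rewrite /h; case: (g s) => x t /= def_s.
by exists t; rewrite -{1}def_s; congr lift_perm; rewrite -def_s lift_perm_id.
Qed.

(** * Counting by the last letter *)

(* The numbers are indexed by [N = k - 1], the number of values that a left rank
   can take in a permutation avoiding Lambda_k. *)
Definition alt_count p N m : nat :=
  #|[set s : 'S_m | alt_perm p s && avoids_Lambda N.+1 s]|.

(** The last value is the last left rank, so this counts the words of [m + 1] left ranks ending in
    [x]. *)
Definition last_count p N m x : nat :=
  #|[set s : 'S_m.+1 | alt_perm p s && avoids_Lambda N.+1 s
                       && (s ord_max == x :> nat)]|.

Lemma card_last_count p N m (P : pred nat) :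
  #|[set s : 'S_m.+1 | alt_perm p s && avoids_Lambda N.+1 s
                       && P (s ord_max)]|
  = \sum_(y < N | P y) last_count p N m y.
Proof.
under eq_bigr => y _ do rewrite /last_count -sum1dep_card big_mkcondr /=.
rewrite exchange_big -sum1dep_card big_mkcondr /=; apply: eq_bigr => s.
case/andP => _ /avoids_LambdaP/(_ ord_max); rewrite left_rank_max => lt_sN.
case: ifP => Ps.
  rewrite (bigD1 (Ordinal lt_sN)) //= eqxx big1 // => y /andP[_].
  by rewrite -val_eqE eq_sym /= => /negbTE->.
by rewrite big1 // => y Py; case: eqP => // sy; rewrite sy Py in Ps.
Qed.

Lemma alt_countS p N m : alt_count p N m.+1 = \sum_(y < N) last_count p N m y.
Proof.
rewrite -(card_last_count p N m predT).
by congr #|pred_of_set _|; apply/setP => s; rewrite !inE andbT.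
Qed.

Lemma alt_count0 p N : alt_count p N 0 = 1.
Proof.
rewrite -[RHS](card_Sn 0); apply: eq_card => s; rewrite !inE.
by rewrite avoids_Lambda_small // andbT; apply/alt_permP; case.
Qed.

Lemma last_count0 p N x : 0 < N -> last_count p N 0 x = (x == 0).
Proof.
move=> N_gt0; have val0 (s : 'S_1) : s ord_max = 0 :> nat by rewrite ord1.
have avs (s : 'S_1) : alt_perm p s && avoids_Lambda N.+1 s.
  by rewrite avoids_Lambda_small // andbT; apply/alt_permP => i j; rewrite !ord1.
rewrite /last_count; case: eqP => [-> | /eqP x_neq0].
  by rewrite -[RHS](card_Sn 1); apply: eq_card => s; rewrite !inE avs val0.
by apply/eqP; rewrite cards_eq0; apply/eqP/setP => s; rewrite !inE avs val0 eq_sym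
  (negbTE x_neq0).
Qed.

(** Deleting the last entry leaves a word ending in some [y]. The two bounds on [x] make it an
    admissible next letter: avoidance requires [x < N], and a left rank is at most its index. *)
Lemma last_countS p N m x : x < N -> x < m.+2 ->
  last_count p N m.+1 x =
  \sum_(y < N | if odd m (+) p then x <= y else y < x) last_count p N m y.
Proof.
move=> lt_xN lt_xm.
rewrite -(card_last_count p N m
  (fun y => if odd m (+) p then x <= y else y < x)).
pose h : 'S_m.+1 -> 'S_m.+2 := lift_perm ord_max (Ordinal lt_xm).
have h_inj : injective h.
  move=> t u /permP eq_h; apply/permP => j.
  by have := eq_h (lift ord_max j); rewrite !lift_perm_lift => /lift_inj.
rewrite -(card_imset _ h_inj); congr #|pred_of_set _|; apply/setP => s.
rewrite inE; apply/idP/imsetP => [/andP[Hs /eqP sx] | [t]].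
  have [t def_s] := lift_perm_surj ord_max s.
  have def_x : s ord_max = Ordinal lt_xm by apply: val_inj.
  exists t; last by rewrite def_s def_x.
  move: Hs; rewrite def_s def_x alt_perm_lift avoids_Lambda_lift lt_xN andbT.
  by rewrite inE -!andbA => /and3P[-> -> ->].
rewrite inE => /andP[/andP[Ht1 Ht2] Ht3] ->.
rewrite alt_perm_lift avoids_Lambda_lift lt_xN Ht1 Ht2 lift_perm_id /= eqxx.
by rewrite Ht3.
Qed.

(** * Euler numbers and complementation *)

Definition euler_number m : nat := alt_count false m m.

Lemma alt_perm_rev p m (s : 'S_m) :
  alt_perm p (s * perm rev_ord_inj)%g = alt_perm (~~ p) s.
Proof.
by apply/alt_permP/alt_permP => H i j /H; rewrite !permM !permE /= addbN;
  have := ltn_ord (s i); have := ltn_ord (s j); case: (odd i (+) p) => /=; lia.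
Qed.

(** Avoidance is automatic here, and complementing the values exchanges the two kinds. *)
Lemma alt_count_small p N m : m <= N -> alt_count p N m = euler_number m.
Proof.
move=> le_mN.
have drop_avoid q M : m <= M -> alt_count q M m = #|[set s : 'S_m | alt_perm q s]|.
  move=> le_mM; apply: eq_card => s; rewrite !inE.
  by rewrite (avoids_Lambda_small s le_mM) andbT.
rewrite /euler_number !drop_avoid //.
case: p => //; rewrite -(card_imset _ (mulIg (perm (@rev_ord_inj m)))).
apply: eq_card => s; rewrite inE; apply/imsetP/idP => [[t] | alt_s].
  by rewrite inE => alt_t ->; rewrite alt_perm_rev.
exists (s * (perm (@rev_ord_inj m))^-1)%g; last by rewrite mulgKV.
by rewrite inE -[true]/(~~ false) -alt_perm_rev mulgKV.
Qed.

Lemma euler_number_le m : euler_number m <= m`!.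
Proof. by rewrite -card_Sn; apply: max_card. Qed.

(** * Alternating words continued by increasing ones *)

(** The summand counts the subsets of {0, ..., N - 1} of size [r + 1] with least element [x]. *)
Lemma sum_bin_rev N r : \sum_(x < N) 'C(N.-1 - x, r) = 'C(N, r.+1).
Proof.
elim: N => [|N IHN]; first by rewrite big_ord0.
rewrite big_ord_recl subn0 binS -IHN addnC; congr (_ + _).
by apply: eq_bigr => x _; congr 'C(_, _); rewrite /= /bump /=; lia.
Qed.

Lemma sum_bin_rev_gt N y r :
  \sum_(x < N | y < x) 'C(N.-1 - x, r) = 'C(N.-1 - y, r.+1).
Proof.
elim: N y => [|N IHN] y; first by rewrite big_ord0 sub0n.
rewrite big_mkcond big_ord_recl ltn0 /= add0n -big_mkcond /=.
case: y => [|y]; last first.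
  rewrite -(_ : N.-1 - y = N - y.+1); last by lia.
  rewrite -IHN; apply: eq_big => x; rewrite /bump /= ?add1n //.
  by move=> _; congr 'C(_, _); lia.
rewrite subn0 -sum_bin_rev; apply: eq_big => x; rewrite /bump /= ?add1n //.
by move=> _; congr 'C(_, _); lia.
Qed.

(* If [N <= q + r + 1], the number of words of left ranks of length [q + 1 + r]
   whose first [q + 1] letters alternate and whose last [r + 1] letters increase
   strictly. *)
Definition junction p N q r : nat :=
  \sum_(y < N) last_count p N q y * 'C(N.-1 - y, r).

Lemma junction0 p N q : junction p N q 0 = alt_count p N q.+1.
Proof. by rewrite alt_countS; apply: eq_bigr => y _; rewrite bin0 muln1. Qed.

Lemma junctionS p N q r : N <= q + r.+2 ->
  junction p N q.+1 r =
  \sum_(y < N) last_count p N q y *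
    \sum_(x < N | if odd q (+) p then x <= y else y < x) 'C(N.-1 - x, r).
Proof.
move=> le_N; rewrite /junction.
under [RHS]eq_bigr do rewrite big_distrr /=.
rewrite (exchange_big_dep predT) //=; apply: eq_bigr => x _.
have [lt_xq | le_qx] := ltnP x q.+2.
  by rewrite last_countS // big_distrl.
(* A letter too large for [last_countS] leaves fewer than [r] values above it, so its term
   vanishes. *)
rewrite bin_small ?muln0; last by have := ltn_ord x; lia.
by rewrite big1 // => y _; rewrite muln0.
Qed.

(** The left side counts pairs of words. Let [y] end the first and [x] start the second: if [y < x],
    then [y] joins the increasing word; otherwise [x] extends the alternating one by the descent
    due. *)
Lemma junction_down p N q r : odd q (+) p -> N <= q + r.+2 ->
  'C(N, r.+1) * alt_count p N q.+1 = junction p N q r.+1 + junction p N q.+1 r.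
Proof.
move=> odd_q le_N; rewrite junctionS // odd_q alt_countS big_distrr -big_split /=.
apply: eq_bigr => y _; rewrite -mulnDr mulnC; congr (_ * _).
rewrite -sum_bin_rev (bigID (fun x : 'I_N => y < x)) /= sum_bin_rev_gt.
by congr (_ + _); apply: eq_bigl => x; rewrite -leqNgt.
Qed.

(** When an ascent is due, the first step of the increasing part may equally be counted in the
    alternating part. *)
Lemma junction_up p N q r : ~~ (odd q (+) p) -> N <= q + r.+2 ->
  junction p N q.+1 r = junction p N q r.+1.
Proof.
move=> even_q le_N; rewrite junctionS // (negbTE even_q).
by apply: eq_bigr => y _; rewrite sum_bin_rev_gt.
Qed.

(** A nonzero binomial forces [r = N - 1] and [y = 0]. Then [q] is positive, and the letter 0 would
    have to be reached by an ascent. *)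
Lemma junction_eq0 p N q r : odd q (+) p -> 0 < N <= r.+1 -> N < q.+1 + r ->
  junction p N q r = 0.
Proof.
move=> odd_q /andP[N_gt0 le_Nr] lt_N; apply: big1 => y _.
have [lt_r|le_r] := ltnP (N.-1 - y) r; first by rewrite bin_small ?muln0.
have ltyN := ltn_ord y.
have -> : nat_of_ord y = 0 by lia.
case: q => [|q] in odd_q lt_N *; first by lia.
move: odd_q; rewrite /= addNb => /negbTE even_q.
by rewrite last_countS // even_q big_pred0.
Qed.

(** The only such word is 0, 1, ..., N - 1. *)
Lemma junction_start p N : 0 < N -> junction p N 0 N.-1 = 1.
Proof.
case: N => // N _; rewrite /junction big_ord_recl last_count0 // subn0 binn.
by rewrite big1 // => y _; rewrite last_count0.
Qed.

(** * The telescoping sums *)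

Local Open Scope ring_scope.

(** By [junction_down] each term is a sum of two junctions, one of which cancels the previous
    remainder through [junction_up]. The parity condition covers a(2n) and b(2n+1). *)
Lemma alt_count_even_partial p N m I : odd m = p -> (N <= m)%N -> (I.*2 < m)%N ->
  \sum_(1 <= i < I.+1) (-1) ^+ (i + 1) * ('C(N, 2 * i))%:Z
    * (alt_count p N (m - 2 * i))%:Z =
  (alt_count p N m)%:Z + (-1) ^+ I.+1 * (junction p N (m.-1 - I.*2) I.*2)%:Z.
Proof.
move=> odd_m le_Nm; elim: I => [|I IHI] lt_Im.
  by rewrite big_geq // double0 subn0 junction0 prednK // expr1 mulN1r subrr.
rewrite big_nat_recr //= IHI; last by lia.
have [q def_m] : exists q, m = (q + I.*2).+3 by exists (m - I.*2.+3)%N; lia.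
have odd_q : odd q (+) p.
  by rewrite -odd_m def_m /= oddD odd_double; case: odd.
have -> : (m - 2 * I.+1 = q.+1)%N by lia.
have -> : (m.-1 - I.*2 = q.+2)%N by lia.
have -> : (m.-1 - I.+1.*2 = q)%N by lia.
have -> : (2 * I.+1 = I.*2.+2)%N by lia.
rewrite addn1 -mulrA -PoszM junction_down //; last by lia.
rewrite -(@junction_up _ _ q.+1); [|by rewrite /= addNb odd_q|by lia].
rewrite doubleS PoszD !exprS; ring.
Qed.

Lemma alt_count_odd_partial p N m I : odd m = ~~ p -> (N <= m)%N ->
    (I.*2.+1 < m)%N ->
  \sum_(0 <= i < I.+1) (-1) ^+ i * ('C(N, 2 * i + 1))%:Z
    * (alt_count p N (m - 2 * i - 1))%:Z =
  (alt_count p N m)%:Z + (-1) ^+ I * (junction p N (m.-2 - I.*2) I.*2.+1)%:Z.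
Proof.
move=> odd_m le_Nm; elim: I => [|I IHI] lt_Im.
  have [q def_m] : exists q, m = q.+2 by exists m.-2; lia.
  rewrite big_nat1 def_m !expr0 !mul1r muln0 !subn0 subn1 /= ?double0 ?subn0.
  rewrite -PoszM junction_down ?junction0; first by rewrite PoszD addrC.
    by move: odd_m; rewrite def_m /= negbK => ->; case: p.
  by lia.
rewrite big_nat_recr //= IHI; last by lia.
have [q def_m] : exists q, m = (q + I.*2).+4 by exists (m - I.*2.+4)%N; lia.
have odd_q : odd q (+) p.
  move: odd_m; rewrite def_m /= oddD odd_double !negbK addbF => ->.
  by rewrite addNb addbb.
have -> : (m - 2 * I.+1 - 1 = q.+1)%N by lia.
have -> : (m.-2 - I.*2 = q.+2)%N by lia.
have -> : (m.-2 - I.+1.*2 = q)%N by lia.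
have -> : (2 * I.+1 + 1 = I.*2.+3)%N by lia.
rewrite -mulrA -PoszM junction_down //; last by lia.
rewrite -(@junction_up _ _ q.+1); [|by rewrite /= addNb odd_q|by lia].
rewrite doubleS PoszD !exprS; ring.
Qed.

Lemma alt_count_even p N m : (0 < N < m)%N -> odd m = p ->
  (alt_count p N m)%:Z =
  \sum_(1 <= i < (N %/ 2).+1) (-1) ^+ (i + 1) * ('C(N, 2 * i))%:Z
    * (alt_count p N (m - 2 * i))%:Z.
Proof.
case/andP => N_gt0 lt_Nm odd_m; rewrite alt_count_even_partial //; try by lia.
(* At [I = N %/ 2] the increasing part has [2 * I + 1 >= N] letters, so the remainder vanishes. *)
rewrite junction_eq0 ?mulr0 ?addr0 //; try by lia.
Qed.

Lemma alt_count_odd p N m : (1 < N < m)%N -> odd m = ~~ p ->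
  (alt_count p N m)%:Z =
  \sum_(0 <= i < ((N - 1) %/ 2).+1) (-1) ^+ i * ('C(N, 2 * i + 1))%:Z
    * (alt_count p N (m - 2 * i - 1))%:Z.
Proof.
case/andP => N_gt1 lt_Nm odd_m; rewrite alt_count_odd_partial //; try by lia.
rewrite junction_eq0 ?mulr0 ?addr0 //; try by lia.
Qed.

(** * The exponential generating function *)

Lemma euler_number_rec m :
  \sum_(0 <= i < (m./2).+1) (-1) ^+ i * ('C(m, 2 * i))%:Z
    * (euler_number (m - 2 * i))%:Z =
  if m == 0%N then 1 else if odd m then (-1) ^+ m./2 else 0.
Proof.
have [-> | m_neq0] := eqVneq; first by rewrite big_nat1 /euler_number alt_count0.
(* The largest [I] with [I.*2 < m], as the partial sum requires. *)
pose I := m.-1./2.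
pose F i : int := (-1) ^+ i * ('C(m, 2 * i))%:Z * (euler_number (m - 2 * i))%:Z.
have sum_F : \sum_(0 <= i < I.+1) F i =
    (-1) ^+ I * (junction (odd m) m (m.-1 - I.*2) I.*2)%:Z.
  rewrite big_ltn // [F 0%N]/F muln0 subn0 expr0 bin0 !mul1r.
  have lt_Im : (I.*2 < m)%N by lia.
  have := alt_count_even_partial (erefl (odd m)) (leqnn m) lt_Im.
  rewrite alt_count_small // exprS => partial_sum.
  rewrite (eq_big_nat _ _ (F2 := fun i => - ((-1) ^+ (i + 1)
    * ('C(m, 2 * i))%:Z * (alt_count (odd m) m (m - 2 * i))%:Z))).
    by rewrite sumrN partial_sum; ring.
  by move=> i _; rewrite alt_count_small ?leq_subr // /F exprD expr1; ring.
case: ifP => odd_m.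
  have -> : m./2 = I by lia.
  rewrite sum_F; have -> : (m.-1 - I.*2 = 0)%N by lia.
  have -> : (I.*2 = m.-1)%N by lia.
  by rewrite junction_start ?mulr1 //; lia.
have -> : m./2 = I.+1 by lia.
(* For even [m] one term remains, with [2 * i = m]; it cancels the remainder. *)
rewrite big_nat_recr //= sum_F odd_m; have -> : (m.-1 - I.*2 = 1)%N by lia.
rewrite junction_up //; last by lia.
have -> : (I.*2.+1 = m.-1)%N by lia.
have -> : (2 * I.+1 = m)%N by lia.
rewrite junction_start; last by lia.
by rewrite binn subnn /euler_number alt_count0 exprS; ring.
Qed.

Lemma sum_even_nat (V : zmodType) (G : nat -> V) n :
  \sum_(0 <= j < n.+1 | ~~ odd j) G j = \sum_(0 <= i < (n./2).+1) G (2 * i)%N.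
Proof.
elim: n => [|n IHn]; first by rewrite big_nat1 big_mkcond big_nat1.
rewrite big_mkcond big_nat_recr //= -big_mkcond IHn /= uphalf_half.
case: ifP => [even_n | odd_n].
  rewrite -[odd n]negbK even_n add1n [RHS]big_nat_recr //=.
  by congr (_ + G _); lia.
by rewrite -[odd n]negbK odd_n add0n addr0.
Qed.

Lemma sum_antidiagonal (V : zmodType) (F : nat -> nat -> V) M :
  \sum_(0 <= n < M) \sum_(0 <= i < n.+1) F i (n - i)%N =
  \sum_(0 <= i < M) \sum_(0 <= j < M - i) F i j.
Proof.
elim: M => [|M IHM]; first by rewrite !big_geq.
rewrite big_nat_recr //= {}IHM [in LHS]big_nat_recr //= subnn.
rewrite [RHS]big_nat_recr //= subSnn big_nat1 addrA; congr (_ + _).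
rewrite -big_split; apply: eq_big_nat => i lt_iM.
by rewrite subSn ?big_nat_recr //=; lia.
Qed.

(** The difference consists of the terms with [i, j < M <= i + j]: at most M^2 terms, each at most
    |t|^M. Since M^2 <= 4^M, it is bounded by (4|t|)^M. *)
Lemma cauchy_product_cvg (R : realType) (a b : nat -> R) (t : R) :
    (forall n, `|a n| <= 1) -> (forall n, `|b n| <= 1) -> `|t| < 4^-1 ->
  (pseries a t M * pseries b t M -
   pseries (fun n => \sum_(0 <= i < n.+1) a i * b (n - i)%N) t M
     @[M --> \oo] --> (0 : R))%classic.
Proof.
move=> le_a le_b lt_t.
have lt_4t : `|4 * `|t| | < 1.
  by rewrite ger0_norm ?mulr_ge0 // -(ltr_pM2l (x := 4^-1)) ?mulKf ?mulr1 ?invr_gt0.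
apply: norm_cvg0; apply: (squeeze_cvgr _ (cvg_cst 0) (cvg_geometric 1 lt_4t)).
apply: nearW => M; rewrite normr_ge0 /= /geometric /= mul1r.
rewrite /pseries /series /= big_distrlr /=.
have -> : \sum_(0 <= n < M) (\sum_(0 <= i < n.+1) a i * b (n - i)%N) * t ^+ n =
  \sum_(0 <= i < M) \sum_(0 <= j < M - i) (a i * t ^+ i) * (b j * t ^+ j).
  rewrite -sum_antidiagonal; apply: eq_bigr => n _; rewrite big_distrl /=.
  apply: eq_big_nat => i /andP[_ le_in].
  by rewrite mulrACA -exprD subnKC.
rewrite -sumrB; apply: le_trans (ler_norm_sum _ _ _) _.
apply: (@le_trans _ _ (\sum_(0 <= i < M) \sum_(0 <= j < M) `|t| ^+ M)).
  apply: ler_sum_nat => i /andP[_ lt_iM].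
  rewrite (big_cat_nat _ (n := M - i)) ?leq_subr //= addrAC subrr add0r.
  apply: le_trans (ler_norm_sum _ _ _) _.
  rewrite [leRHS](big_cat_nat _ (n := M - i)) ?leq_subr //=.
  rewrite -[leLHS]add0r; apply: lerD; first by apply: sumr_ge0 => *; rewrite exprn_ge0.
  apply: ler_sum_nat => j /andP[le_j _]; rewrite mulrACA -exprD normrM normrX.
  rewrite -[leRHS]mul1r; apply: ler_pM => //.
    by rewrite normrM -[1]mulr1; apply: ler_pM.
  apply: ler_wiXn2l => //; last by lia.
  by apply: ltW (lt_trans lt_t _); rewrite invf_lt1 // ltr1n.
rewrite !sumr_const_nat !subn0 -mulrnA exprMn -[leLHS]mulr_natl.
rewrite ler_wpM2r ?exprn_ge0 // -natrX ler_nat.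
by rewrite (_ : 4 = 2 * 2)%N // expnMn; apply: leq_mul; apply: ltnW; apply: ltn_expl.
Qed.

(** The product with the cosine series tends to 1 + sin t; dividing by the cosine partial sums,
    eventually nonzero, also yields convergence of the series itself. *)
Lemma sec_tan_egf_euler_number (R : realType) : sec_tan_egf R euler_number.
Proof.
(* Coefficients of the Euler series, of the cosine, and of their Cauchy product. *)
pose e n : R := (euler_number n)%:R / n`!%:R.
pose c n : R := (~~ odd n)%:R * (-1) ^+ n./2 / n`!%:R.
pose d n : R := \sum_(0 <= i < n.+1) c i * e (n - i)%N.
have fact_neq0 n : n`!%:R != 0 :> R by rewrite pnatr_eq0 -lt0n fact_gt0.
have le_e n : `|e n| <= 1.
  rewrite ger0_norm ?divr_ge0 // ler_pdivrMr ?ltr0n ?fact_gt0 // mul1r ler_nat.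
  exact: euler_number_le.
have le_c n : `|c n| <= 1.
  rewrite /c !normrM normrX normrN1 expr1n mulr1 normfV !normr_nat.
  rewrite ler_pdivrMr ?ltr0n ?fact_gt0 // mul1r ler_nat.
  by apply: leq_trans (fact_gt0 n); case: odd.
have dE n : d n = (n == 0%N)%:R + (odd n)%:R * (-1) ^+ n.-1./2 / n`!%:R.
  have -> : d n = (\sum_(0 <= i < n.+1 | ~~ odd i)
      (-1) ^+ i./2 * 'C(n, i)%:R * (euler_number (n - i))%:R) / n`!%:R.
    rewrite big_distrl [RHS]big_mkcond; apply: eq_big_nat => i /andP[_ le_in].
    rewrite /c; case: odd; rewrite /= ?mul0r // mul1r -(@bin_fact n i le_in) !natrM.
    have nz_bin : 'C(n, i)%:R != 0 :> R by rewrite pnatr_eq0 -lt0n bin_gt0.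
    by rewrite /e; field; rewrite !fact_neq0 nz_bin.
  rewrite sum_even_nat.
  under eq_bigr do rewrite {1}mul2n doubleK.
  have /(congr1 (fun z : int => z%:~R : R)) := euler_number_rec n.
  rewrite rmorph_sum /=.
  under eq_bigr do rewrite !rmorphM rmorphXn rmorphN1 /=.
  move=> ->; case: eqVneq => [-> | n_neq0]; first by rewrite mul1r invr1 mul0r mul0r addr0.
  rewrite add0r; case: ifP => odd_n; last by rewrite !mul0r.
  rewrite rmorphXn rmorphN1 mul1r; congr (_ ^+ _ / _); lia.
have cos_series (t : R) : (pseries c t @ \oo --> cos t)%classic.
  have : (series (cos_coeff t) @ \oo --> cos t)%classic.
    by rewrite unlock; apply: is_cvg_series_cos_coeff.
  by rewrite cos_coeffE.
have sin_series (t : R) : (pseries d t @ \oo --> 1 + sin t)%classic.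
  have : (series (sin_coeff t) @ \oo --> sin t)%classic.
    by rewrite unlock; apply: is_cvg_series_sin_coeff.
  rewrite sin_coeffE => /(cvgD (cvg_cst (1 : R))); apply: cvg_trans.
  apply: near_eq_cvg; near=> M.
  (* The empty partial sum lacks the constant term 1. *)
  have M_gt0 : (0 < M)%N by near: M; apply: nbhs_infty_gt.
  rewrite /pseries /series /=; under [RHS]eq_bigr do rewrite dE mulrDl.
  rewrite big_split /= (big_ltn M_gt0) mul1r expr0 big_nat big1 ?addr0 //.
  by move=> [|n] // _; rewrite mul0r.
near=> t.
have cos_t : cos t != 0.
  near: t; have /cvgr_neq0 := @continuous_cos R 0; apply.
  by rewrite cos0 oner_neq0.
have lt_t : `|t| < 4^-1.
  near: t; apply: (@nbhs0_lt _ R^o); by rewrite invr_gt0 ltr0n.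
have prod_cvg : (pseries c t M * pseries e t M @[M --> \oo] --> 1 + sin t)%classic.
  have := cvgD (cauchy_product_cvg le_c le_e lt_t) (sin_series t).
  rewrite add0r => sum_cvg; apply: (cvg_trans _ (sum_cvg _)); apply: near_eq_cvg; near=> M.
  by rewrite /= subrK.
have := cvgM prod_cvg (cvgV cos_t (cos_series t)).
rewrite mulrDl mul1r => quot_cvg; apply: (cvg_trans _ (quot_cvg _ _)).
apply: near_eq_cvg.
have /cvgr_neq0/(_ cos_t) := cos_series t; apply: filterS => M c_neq0.
by rewrite /= mulrAC mulfV ?mul1r.
Unshelve. all: by end_near.
Qed.

(** * The four recurrences *)

Lemma num_up_downE N m : num_up_down N.+1 m = alt_count false N m.
Proof. by apply: eq_card => s; rewrite !inE up_down_alt_perm. Qed.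

Lemma num_down_upE N m : num_down_up N.+1 m = alt_count true N m.
Proof. by apply: eq_card => s; rewrite !inE down_up_alt_perm. Qed.

Unset Implicit Arguments.

Theorem theorem4 (R : realType) (k : nat) (hk : (3 <= k)%N) :
  (exists E : nat -> nat,
     sec_tan_egf R E /\
     (forall m : nat, (m < k)%N ->
        num_up_down k m = E m /\ num_down_up k m = E m)) /\
  (forall n : nat, (k <= 2 * n)%N ->
     (num_up_down k (2 * n))%:Z =
     \sum_(1 <= i < ((k - 1) %/ 2).+1)
        (-1) ^+ (i + 1) * ('C(k - 1, 2 * i))%:Z
          * (num_up_down k (2 * n - 2 * i))%:Z) /\
  (forall n : nat, (k <= 2 * n + 1)%N ->
     (num_up_down k (2 * n + 1))%:Z =
     \sum_(0 <= i < ((k - 2) %/ 2).+1)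
        (-1) ^+ i * ('C(k - 1, 2 * i + 1))%:Z
          * (num_up_down k (2 * n - 2 * i))%:Z) /\
  (forall n : nat, (k <= 2 * n)%N ->
     (num_down_up k (2 * n))%:Z =
     \sum_(0 <= i < ((k - 2) %/ 2).+1)
        (-1) ^+ i * ('C(k - 1, 2 * i + 1))%:Z
          * (num_down_up k (2 * n - 2 * i - 1))%:Z) /\
  (forall n : nat, (k <= 2 * n + 1)%N ->
     (num_down_up k (2 * n + 1))%:Z =
     \sum_(1 <= i < ((k - 1) %/ 2).+1)
        (-1) ^+ (i + 1) * ('C(k - 1, 2 * i))%:Z
          * (num_down_up k (2 * n - 2 * i + 1))%:Z).
Proof.
case: k hk => // N lt2N; split; first exists euler_number.
  split; first exact: sec_tan_egf_euler_number.
  by move=> m lt_mk; rewrite num_up_downE num_down_upE !alt_count_small.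
have -> : (N.+1 - 1 = N)%N by lia.
have -> : (N.+1 - 2 = N - 1)%N by lia.
split; [|split; [|split]] => n le_kn; rewrite ?num_up_downE ?num_down_upE.
- rewrite alt_count_even; [|by lia|by lia].
  by apply: eq_bigr => i _; rewrite num_up_downE.
- rewrite alt_count_odd; [|by lia|by lia].
  apply: eq_bigr => i _; rewrite num_up_downE.
  by congr (_ * (alt_count _ _ _)%:Z); lia.
- rewrite alt_count_odd; [|by lia|by lia].
  by apply: eq_bigr => i _; rewrite num_down_upE.
- rewrite alt_count_even; [|by lia|by lia].
  (* The range of [i] is kept: [2 * n + 1 - 2 * i] and [2 * n - 2 * i + 1] agree under truncated
     subtraction because [i <= n]. *)
  apply: eq_big_nat => i lt_i; rewrite num_down_upE.
  by congr (_ * (alt_count _ _ _)%:Z); lia.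
Qed.
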